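(* Let $Z$ and $Y$ be Hilbert spaces, $A:Z\to Y$ an injective bounded linear operator with non-closed range, and $\mathcal{R}:Z\to[0,\infty]$ a convex, lower semi-continuous and stabilizing functional with domain $\mathcal{D}(\mathcal{R})=\{x\in Z:\mathcal{R}(x)<\infty\}$. Let $x^\dagger\in\mathcal{D}(\mathcal{R})$ and $y=Ax^\dagger$. For $\gamma>0$ and $y^\delta\in Y$ with $\|y-y^\delta\|_Y\le\delta$, let $x^\delta_\gamma$ be the minimizer over $x\in Z$ of $\frac12\|Ax-y^\delta\|_Y^2+\gamma\,\mathcal{R}(x)$. Suppose that for a nonnegative error measure $E:\mathcal{D}(\mathcal{R})\times\mathcal{D}(\mathcal{R})\to\mathbb{R}_+$, constants $0<\lambda\le1$ and $C>0$, and a concave index function $g$, the variational inequality $$\lambda\,E(x,x^\dagger)\le\mathcal{R}(x)-\mathcal{R}(x^\dagger)+C\,g\big(\|A(x-x^\dagger)\|_Y\big)\qquad\text{for all }x\in\mathcal{D}(\mathcal{R})$$ is valid. Then $$E(x^\delta_{\gamma_*},x^\dagger)=\mathcal{O}(g(\delta))\quad\text{as }\delta\to0$$ whenever the regularization parameter $\gamma_*$ is chosen as $\gamma_*=\gamma_{TDP}$ by the two-sided discrepancy principle, as $\gamma_*=\gamma_{SDP}$ by the sequential discrepancy principle, or as $\gamma_*=\gamma_{LEP}$ by the adapted Lepskii principle, the last case provided that $E$ is symmetric, $E(x^{(1)},x^{(2)})=E(x^{(2)},x^{(1)})$, and satisfies $E(x^{(1)},x^{(2)})\le C_E\big(E(x^{(1)},x^{(3)})+E(x^{(3)},x^{(2)})\big)$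 for all $x^{(1)},x^{(2)},x^{(3)}\in\mathcal{D}(\mathcal{R})$ with some constant $1\le C_E<\infty$.
   Context: $\mathcal{R}$ is called stabilizing if the sublevel sets $\{x\in Z:\mathcal{R}(x)\le c\}$ are weakly sequentially compact for all $c\ge0$. An index function is a function $g:(0,\infty)\to(0,\infty)$ that is continuous, strictly increasing, with $\lim_{t\to0^+}g(t)=0$ (extended by $g(0)=0$). Parameter choices, for noise level $\delta>0$ and data $y^\delta$ (the parameter is assumed to exist): - Two-sided discrepancy principle (TDP), with prescribed $1\le\tau_1\le\tau_2<\infty$: $\gamma_{TDP}>0$ is such that $\tau_1\delta\le\|Ax^\delta_{\gamma_{TDP}}-y^\delta\|_Y\le\tau_2\delta$. - Sequential discrepancy principle (SDP), with prescribed $\tau>1$, $0<q<1$, $\gamma_0>0$: $\gamma_{SDP}\in\{q^j\gamma_0: j=0,1,2,\dots\}$ is such that $\|Ax^\delta_{\gamma_{SDP}}-y^\delta\|_Y\le\tau\delta<\|Ax^\delta_{\gamma_{SDP}/q}-y^\delta\|_Y$. - Adapted Lepskii principle (LEP), with prescribed $0<q<1$ and $\gamma_0>0$, where $\gamma_0$ (possibly depending on $\delta$) is small enough that $E(x^\delta_{\gamma_0},x^\dagger)\le\Theta(\gamma_0)$, with $\Theta(\gamma):=\frac{17\delta^2}{2\lambda\gamma}$: let $\widetilde\Delta_q:=\{\gamma_0/q^j: j=0,1,2,\dots\}$; $\gamma_{LEP}$ is the largest $\gamma\in\widetilde\Delta_q$ such that $E(x^\delta_{\gamma'},x^\delta_\gamma)\le2C_E\,\Theta(\gamma')$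 for all $\gamma'\in\widetilde\Delta_q$ with $\gamma_0\le\gamma'<\gamma$. *)

(* Defs.v *)
From HB Require Import structures.
From mathcomp Require Export all_boot all_order all_algebra.
From mathcomp Require Export sesquilinear.
From mathcomp Require Export all_classical all_reals all_analysis.
Export Order.TTheory GRing.Theory Num.Theory numFieldNormedType.Exports.

Set Implicit Arguments.
Unset Strict Implicit.
Unset Printing Implicit Defensive.

Local Open Scope classical_set_scope.
Local Open Scope ring_scope.

(* Spaces are real; a complex Hilbert space is covered through the real inner
   product Re <., .>, which induces the same norm. *)
Definition is_hilbert (R : realType) (V : completeNormedModType R) : Prop :=
  exists dot : {dot V for (@idfun R)}, forall x : V, dot x x = `|x| ^+ 2.

Definition weak_cvg (R : realType) (V : normedModType R)
    (u : nat -> V) (x : V) : Prop :=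
  forall f : {linear V -> R^o}, continuous f ->
    f (u n) @[n --> \oo] --> f x.

Definition weakly_seq_compact (R : realType) (V : normedModType R)
    (S : set V) : Prop :=
  forall u : nat -> V, (forall n, S (u n)) ->
    exists phi : nat -> nat, {homo phi : m n / (m < n)%N} /\
      exists2 x : V, S x & weak_cvg (u \o phi) x.

Section functionals.
Variables (R : realType) (V : normedModType R) (Reg : V -> \bar R).

Definition dom : set V := [set x | (Reg x < +oo)%E].

Definition stabilizing : Prop :=
  forall c : R, 0 <= c -> weakly_seq_compact [set x | (Reg x <= c%:E)%E].

(* For a functional with values in [0, +oo]; recall that 0 * +oo = 0. *)
Definition convex_functional : Prop :=
  forall (x y : V) (t : R), 0 <= t <= 1 ->
    (Reg (t *: x + (1 - t) *: y)%R <= t%:E * Reg x + (1 - t)%:E * Reg y)%E.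

End functionals.

(* An index function is given on ]0, +oo[; a total g : R -> R also carries the
   extension g 0 = 0, and its values at negative reals are irrelevant. *)
Definition index_function (R : realType) (g : R -> R) : Prop :=
  [/\ forall t : R, 0 < t -> 0 < g t,
      {in `]0, +oo[, continuous g},
      {in `]0, +oo[ &, {homo g : s t / s < t}},
      g t @[t --> 0^'+] --> (0 : R)
    & g 0 = 0].

Definition concave_index_function (R : realType) (g : R -> R) : Prop :=
  index_function g /\
  convex_function (`]0, +oo[%classic : set R^o) (fun t : R => - g t).

Section tikhonov.
Variables (R : realType) (Z Y : normedModType R).
Variables (A : Z -> Y) (Reg : Z -> \bar R).

Definition tikhonov_functional (yd : Y) (gamma : R) (x : Z) : \bar R :=
  ((2^-1 * `|A x - yd| ^+ 2)%:E + gamma%:E * Reg x)%E.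

Definition tikhonov_minimizers (yd : Y) (gamma : R) : set Z :=
  [set x | forall z : Z,
     (tikhonov_functional yd gamma x <= tikhonov_functional yd gamma z)%E].

(* xget returns an element of the set as soon as there is one; for A injective
   and bounded and Reg convex, stabilizing and proper, the minimizer exists
   and is unique whenever gamma > 0. *)
Definition tikhonov_minimizer (yd : Y) (gamma : R) : Z :=
  xget 0 (tikhonov_minimizers yd gamma).

End tikhonov.

(* In the three rules below, xr maps gamma to the regularized solution for the
   data yd. *)
Section parameter_choice.
Variables (R : realType) (Z Y : normedModType R).
Variables (A : Z -> Y) (delta : R) (yd : Y) (xr : R -> Z).

Definition is_TDP (tau1 tau2 gamma : R) : Prop :=
  0 < gamma /\
  tau1 * delta <= `|A (xr gamma) - yd| <= tau2 * delta.

Definition is_SDP (tau q gamma0 gamma : R) : Prop :=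
  (exists j : nat, gamma = q ^+ j * gamma0) /\
  `|A (xr gamma) - yd| <= tau * delta < `|A (xr (gamma / q)) - yd|.

Definition lepskii_bound (lambda gamma : R) : R :=
  17%:R * delta ^+ 2 / (2 * lambda * gamma).

Definition lepskii_grid (q gamma0 : R) : set R :=
  [set gamma | exists j : nat, gamma = gamma0 / q ^+ j].

Definition lepskii_admissible (E : Z -> Z -> R) (lambda CE q gamma0 : R) :
    set R :=
  [set gamma | lepskii_grid q gamma0 gamma /\
    forall gamma' : R, lepskii_grid q gamma0 gamma' ->
      gamma0 <= gamma' < gamma ->
      E (xr gamma') (xr gamma) <= 2 * CE * lepskii_bound lambda gamma'].

Definition is_LEP (E : Z -> Z -> R) (lambda CE q gamma0 gamma : R) : Prop :=
  lepskii_admissible E lambda CE q gamma0 gamma /\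
  forall gamma' : R,
    lepskii_admissible E lambda CE q gamma0 gamma' -> gamma' <= gamma.

End parameter_choice.

(* E(x^delta_gamma, xdag) = O(g(delta)) as delta -> 0+, for every gamma that
   rule accepts for the noise level delta and the data yd: the big-O with its
   constant and its neighbourhood of 0 uniform in all data yd satisfying
   |A xdag - yd| <= delta. *)
Definition error_rate (R : realType) (Z Y : normedModType R)
    (A : Z -> Y) (Reg : Z -> \bar R) (E : Z -> Z -> R) (xdag : Z)
    (g : R -> R) (rule : R -> Y -> R -> Prop) : Prop :=
  exists K : R, \forall delta \near 0^'+,
    forall (yd : Y) (gamma : R),
      `|A xdag - yd| <= delta ->
      rule delta yd gamma ->
      E (tikhonov_minimizer A Reg yd gamma) xdag <= K * g delta.

(* Main.v *)
(* For a minimizer x of the Tikhonov functional at gamma with residual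
   d = |A x - yd|, comparison with xdag gives
   d^2 / 2 + gamma (Reg x - Reg xdag) <= delta^2 / 2, and the variational
   inequality gives lambda E(x, xdag) <= Reg x - Reg xdag + C g(d + delta),
   where g(c delta) = O(g(delta)) by concavity.  TDP: d >= delta forces
   Reg x <= Reg xdag.  SDP: the large residual at gamma / q, with E >= 0, forces
   delta^2 / gamma = O(g(delta)), which bounds Reg x - Reg xdag.  LEP: the error
   is at most Theta(gamma) as long as gamma C g(delta) <= delta^2; the largest
   such grid point is admissible, and there Theta = O(g(delta)).
   Minimizers exist by the direct method: the choice operator in
   tikhonov_minimizer returns a minimizer only once there is one. *)
From HB Require Import structures.
Require Import Defs.
From mathcomp Require Import ring lra.

Set Implicit Arguments.
Unset Strict Implicit.
Unset Printing Implicit Defensive.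

Local Open Scope classical_set_scope.
Local Open Scope ring_scope.

(** * Weak convergence in Hilbert spaces *)

(** The functional is [<., w>]. Since [is_hilbert] only asserts that an inner product exists, the
    later weak-limit arguments use it through this expansion. *)
Lemma hilbert_functional (R : realType) (V : completeNormedModType R)
    (hV : is_hilbert V) (w : V) :
  exists f : {linear V -> R^o}, continuous f /\
    forall x, `|x + w| ^+ 2 = `|x| ^+ 2 + 2 * f x + `|w| ^+ 2.
Proof.
have [dot dotE] := hV.
pose f := fun x => dot x w : R^o.
have f_lin : linear f by move=> a x y; rewrite /f linearPl.
pose fL : {linear V -> R^o} :=
  HB.pack f (GRing.isLinear.Build R V R^o *:%R f f_lin).
have fE x : `|x + w| ^+ 2 = `|x| ^+ 2 + 2 * fL x + `|w| ^+ 2.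
  have dotC : dot w x = dot x w.
    by have := hermC dot w x; rewrite expr0 mul1r => ->.
  rewrite -!dotE linearDl !linearDr /= dotC /f.
  by rewrite mulrDl mul1r !addrA.
exists fL; split => //.
(* By polarization [fL] is a combination of squared norms, so its continuity reduces to that of the
   norm. *)
have -> : (fL : V -> R^o) =
    fun x => 2^-1 * (`|x + w| ^+ 2 - `|x| ^+ 2 - `|w| ^+ 2).
  by apply/funext => x; rewrite fE; field.
move=> x; apply: cvgM; first exact: cvg_cst.
have nsq (h : V -> V) : {for x, continuous h} ->
    `|h t| ^+ 2 @[t --> x] --> (`|h x| ^+ 2 : R).
  by move=> ch; rewrite expr2; under eq_fun do rewrite expr2;
    apply: cvgM; apply: cvg_norm.
apply: cvgB; last exact: cvg_cst.
apply: cvgB; apply: nsq; last exact: cvg_id.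
by apply: cvgD; [exact: cvg_id|exact: cvg_cst].
Qed.

Lemma weak_cvg_unique (R : realType) (V : completeNormedModType R)
    (hV : is_hilbert V) (u : nat -> V) (x y : V) :
  weak_cvg u x -> weak_cvg u y -> x = y.
Proof.
move=> ux uy; have [f [fc fE]] := hilbert_functional hV (x - y).
have fxy : f x = f y :> R.
  by apply: (cvg_unique _ (ux f fc) (uy f fc)); exact: norm_hausdorff.
(* With [f (x - y) = 0], expanding the squared norm of [-(x - y) + (x - y)] leaves
   [0 = 2 |x - y|^2]. *)
have := fE (- (x - y)).
rewrite addNr normr0 normrN raddfN raddfB /= fxy subrr oppr0 mulr0 expr0n /=.
rewrite addr0 => /esym/eqP; rewrite -mulr2n mulrn_eq0 /= sqrf_eq0 normr_eq0.
by rewrite subr_eq0 => /eqP.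
Qed.

Lemma homo_ltn_cvg (phi : nat -> nat) :
  {homo phi : m n / (m < n)%N} -> phi n @[n --> \oo] --> \oo.
Proof.
move=> phi_mono P [N _ NP]; exists N => // n /= Nn; apply: NP => /=.
apply: leq_trans Nn _; elim: n => // n IHn.
exact: leq_ltn_trans IHn (phi_mono _ _ _).
Qed.

Lemma weak_cvg_comp (R : realType) (V : normedModType R)
    (u : nat -> V) (x : V) (phi : nat -> nat) :
  phi n @[n --> \oo] --> \oo -> weak_cvg u x -> weak_cvg (u \o phi) x.
Proof.
by move=> phioo ux f fc; apply: (cvg_comp phi (fun n => f (u n)));
  [exact: phioo|exact: ux].
Qed.

(** Compactness gives a subsequence with weak limit in the sublevel set; uniqueness of weak limits
    identifies that limit with [x]. *)
Lemma stabilizing_weak_lsc (R : realType) (V : completeNormedModType R)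
    (hV : is_hilbert V) (Reg : V -> \bar R) (Reg_stab : stabilizing Reg)
    (c : R) (u : nat -> V) (x : V) :
  0 <= c -> (forall n, (Reg (u n) <= c%:E)%E) -> weak_cvg u x ->
  (Reg x <= c%:E)%E.
Proof.
move=> c0 uc ux; have [phi [phi_mono [z zc uz]]] := Reg_stab c c0 u uc.
suff -> : x = z by [].
apply: weak_cvg_unique hV _ _ _ _ uz.
exact: weak_cvg_comp (homo_ltn_cvg phi_mono) ux.
Qed.

(** Expand [|(A u_n - A x) + (A x - b)|^2]: the first square is nonnegative, and the cross term
    [2 <A u_n - A x, A x - b>] tends to 0 because [<A ., A x - b>] is a continuous functional on
    [Z]. *)
Lemma weak_cvg_norm_le (R : realType) (Z Y : completeNormedModType R)
    (hY : is_hilbert Y) (A : {linear Z -> Y}) (A_cont : continuous A)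
    (u : nat -> Z) (x : Z) (b : Y) (e : R) :
  weak_cvg u x -> 0 < e ->
  \forall n \near \oo, `|A x - b| ^+ 2 <= `|A (u n) - b| ^+ 2 + e.
Proof.
move=> ux e0; have [f [fc fE]] := hilbert_functional hY (A x - b).
pose h : {linear Z -> R^o} := f \o A.
have hc : continuous h.
  by move=> z; apply: continuous_comp; [exact: A_cont|exact: fc].
have e20 : 0 < e / 2 by lra.
have /cvgrPdist_lt /(_ _ e20) := ux h hc.
apply: filterS => n; rewrite ltr_norml => /andP[_ hn].
have -> : A (u n) - b = A (u n) - A x + (A x - b) by rewrite addrA subrK.
rewrite fE raddfB.
have := sqr_ge0 `|A (u n) - A x|.
move: hn; rewrite /h /=.
move: (f _ : R) (f _ : R) (`|_| ^+ 2) (`|_| ^+ 2) => a a' p q.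
lra.
Qed.

(** * Existence of Tikhonov minimizers *)

(** A real-valued version for ordered-field reasoning; [fine] sends [+oo] to 0, so it is meaningful
    on [dom Reg] only. *)
Definition tikhonov_value (R : realType) (Z Y : normedModType R) (A : Z -> Y)
    (Reg : Z -> \bar R) (yd : Y) (gamma : R) (z : Z) : R :=
  2^-1 * `|A z - yd| ^+ 2 + gamma * fine (Reg z).

Section tikhonov_existence.
Variables (R : realType) (Z Y : completeNormedModType R).
Hypotheses (hZ : is_hilbert Z) (hY : is_hilbert Y).
Variables (A : {linear Z -> Y}) (Reg : Z -> \bar R).
Hypotheses (A_cont : continuous A) (Reg_ge0 : forall x : Z, (0 <= Reg x)%E)
  (Reg_stab : stabilizing Reg).
Variables (yd : Y) (gamma : R).
Hypothesis gamma_gt0 : 0 < gamma.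

Local Notation J := (tikhonov_value A Reg yd gamma).

Lemma dom_fineK (z : Z) : dom Reg z -> Reg z = (fine (Reg z))%:E.
Proof. by move=> zdom; rewrite fineK// ge0_fin_numE. Qed.

Lemma tikhonov_functional_dom (z : Z) :
  dom Reg z -> tikhonov_functional A Reg yd gamma z = (J z)%:E.
Proof. by rewrite /tikhonov_functional => /dom_fineK ->. Qed.

Lemma tikhonov_functional_ndom (z : Z) :
  ~ dom Reg z -> tikhonov_functional A Reg yd gamma z = +oo%E.
Proof.
move=> /negP; rewrite -leNgt leye_eq /tikhonov_functional => /eqP ->.
by rewrite mulry gtr0_sg// mul1e.
Qed.

Lemma tikhonov_minimizer_exists (x0 : Z) :
  dom Reg x0 -> exists2 x, dom Reg x & forall z, dom Reg z -> J x <= J z.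
Proof.
move=> x0dom; pose S := J @` dom Reg; pose m := inf S.
have r_ge0 z : 0 <= fine (Reg z) by rewrite fine_ge0.
have J_ge z : gamma * fine (Reg z) <= J z.
  by rewrite lerDr mulr_ge0// ?exprn_ge0// invr_ge0.
have S_lb : has_lbound S.
  by exists 0 => _ [z _ <-]; rewrite (le_trans _ (J_ge z))// mulr_ge0// ltW.
have S_inf : has_inf S by split => //; exists (J x0), x0.
have mJ z : dom Reg z -> m <= J z by move=> zdom; apply: ge_inf => //; exists z.
have /choice[u uP] (n : nat) : exists z, dom Reg z /\ J z < m + n.+1%:R^-1.
  have [|_ [z zdom <-] zm] := @inf_adherent _ S n.+1%:R^-1 _ S_inf.
    by rewrite invr_gt0.
  by exists z.
(* Since [gamma Reg (u n) <= J (u n) <= m + 1], the minimizing sequence lies in one sublevel set of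
   [Reg]. *)
have u_bd n : (Reg (u n) <= ((m + 1) / gamma)%:E)%E.
  have [udom um] := uP n.
  rewrite (dom_fineK udom) lee_fin ler_pdivlMr// mulrC.
  apply: le_trans (J_ge _) _; apply: le_trans (ltW um) _.
  by rewrite lerD2l invf_le1// ler1n.
have c_ge0 : 0 <= (m + 1) / gamma by rewrite -lee_fin (le_trans _ (u_bd 0%N)).
have [phi [phi_mono [x xc vx]]] := Reg_stab c_ge0 u_bd.
pose v := u \o phi.
have xdom : dom Reg x by exact: le_lt_trans xc (ltry _).
exists x => // z /mJ; apply: le_trans; apply/ler_addgt0Pr => e e0.
have [N _ vN] : \forall n \near \oo,
    `|A x - yd| ^+ 2 <= `|A (v n) - yd| ^+ 2 + e /\ J (v n) < m + e / 2.
  near=> n; split; first by near: n; exact: weak_cvg_norm_le.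
  have [_ /lt_le_trans] := uP (phi n); apply; rewrite lerD2l ltW//.
  near: n; have e20 : 0 < e / 2 by lra.
  exact: (homo_ltn_cvg phi_mono (near_infty_natSinv_lt (PosNum e20))).
(* Chosen so that [Reg x <= c] means [J x <= m + e]. The tail of [v] has [Reg <= c]: one [e / 2]
   comes from near-minimality, the other from half the residual estimate. *)
pose c := (m + e - 2^-1 * `|A x - yd| ^+ 2) / gamma.
have vc n : (Reg (v (n + N)%N) <= c%:E)%E.
  have [] := vN (n + N)%N (leq_addl _ _).
  have [vdom _] := uP (phi (n + N)%N).
  rewrite (dom_fineK vdom) lee_fin /c ler_pdivlMr// [_ * gamma]mulrC /tikhonov_value.
  rewrite -/(v _).
  by move: (`|_| ^+ 2) (`|_| ^+ 2) (gamma * _) => p q r; lra.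
have c0 : 0 <= c by rewrite -lee_fin (le_trans _ (vc 0%N)).
have := stabilizing_weak_lsc hZ Reg_stab c0 vc (weak_cvg_comp (cvg_addnr N) vx).
rewrite (dom_fineK xdom) lee_fin /c ler_pdivlMr// [_ * gamma]mulrC /tikhonov_value.
by move: (`|_| ^+ 2) (gamma * _) => p r; lra.
Unshelve. all: by end_near. Qed.

(** A minimizer over [dom Reg] is one over [Z], the functional being [+oo] elsewhere; hence [xget]
    returns a true minimizer, and comparison with [x0] puts it in the domain. *)
Lemma tikhonov_minimizerP (x0 : Z) : dom Reg x0 ->
  let x := tikhonov_minimizer A Reg yd gamma in
  dom Reg x /\ J x <= J x0.
Proof.
move=> x0dom x.
have [z zdom zmin] := tikhonov_minimizer_exists x0dom.
have : tikhonov_minimizers A Reg yd gamma x.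
  apply: (@xgetI _ 0 _ z) => w.
  rewrite tikhonov_functional_dom//.
  have [wdom|wndom] := pselect (dom Reg w).
    by rewrite tikhonov_functional_dom// lee_fin zmin.
  by rewrite tikhonov_functional_ndom// leey.
move=> /(_ x0); rewrite (tikhonov_functional_dom x0dom) => xx0.
have xdom : dom Reg x.
  apply: contrapT => xndom.
  by move: xx0; rewrite tikhonov_functional_ndom// leye_eq.
by move: xx0; rewrite tikhonov_functional_dom// lee_fin.
Qed.

End tikhonov_existence.

(** * Growth of concave index functions *)

Lemma index_function_le (R : realType) (g : R -> R) (s t : R) :
  index_function g -> 0 <= s -> s <= t -> g s <= g t.
Proof.
move=> [g_gt0 _ g_mono _ g0] s0; rewrite le_eqVlt => /predU1P[-> //|st].
have t0 := le_lt_trans s0 st; apply: ltW.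
move: s0; rewrite le_eqVlt => /predU1P[<-|s0]; first by rewrite g0 g_gt0.
by rewrite g_mono// in_itv/= ?s0 ?t0.
Qed.

(** The point [delta] is the convex combination of [c delta] and [delta / 2] with weight
    [1 / (2 c - 1)] on the former. The anchor [delta / 2] stands in for 0, as concavity is given on
    the open half-line. *)
Lemma concave_index_scale (R : realType) (g : R -> R) (c delta : R) :
  concave_index_function g -> 1 <= c -> 0 < delta ->
  g (c * delta) <= 2 * c * g delta.
Proof.
move=> [[g_gt0 _ _ _ _] g_conc] c1 d0.
have k0 : 0 < 2 * c - 1 by lra.
have t0 : 0 <= (2 * c - 1)^-1 by rewrite invr_ge0 ltW.
have t1 : (2 * c - 1)^-1 <= 1 by rewrite invf_le1//; lra.
have cd0 : 0 < c * delta by rewrite mulr_gt0//; lra.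
have d20 : 0 < delta / 2 by lra.
pose t := (2 * c - 1)^-1.
have gle : - g (t * (c * delta) + (1 - t) * (delta / 2)) <=
    t * - g (c * delta) + (1 - t) * - g (delta / 2).
  by apply: (g_conc (Itv01 t0 t1)); rewrite in_setE/= in_itv/= ?cd0 ?d20.
have tE : t * (c * delta) + (1 - t) * (delta / 2) = delta.
  by rewrite /t; field; rewrite gt_eqF.
rewrite tE in gle.
have g20 := g_gt0 _ d20.
have : t * g (c * delta) <= g delta.
  have : 0 <= (1 - t) * g (delta / 2) by rewrite mulr_ge0 ?subr_ge0// ltW.
  by lra.
rewrite /t mulrC ler_pdivrMr// => /le_trans; apply.
have := g_gt0 _ d0; nra.
Qed.

(** * Error estimates at a fixed noise level *)

Section rates.
Variables (R : realType) (Z Y : completeNormedModType R).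
Hypotheses (hZ : is_hilbert Z) (hY : is_hilbert Y).
Variables (A : {linear Z -> Y}) (Reg : Z -> \bar R).
Hypotheses (A_cont : continuous A) (Reg_ge0 : forall x : Z, (0 <= Reg x)%E)
  (Reg_stab : stabilizing Reg).
Variables (xdag : Z) (E : Z -> Z -> R).
Hypotheses (xdag_dom : dom Reg xdag)
  (E_ge0 : forall x1 x2 : Z, dom Reg x1 -> dom Reg x2 -> 0 <= E x1 x2).
Variables (lambda C : R) (g : R -> R).
Hypotheses (lambda_gt0 : 0 < lambda) (C_gt0 : 0 < C)
  (g_index : concave_index_function g)
  (VI : forall x : Z, dom Reg x ->
     ((lambda * E x xdag)%:E
        <= Reg x - Reg xdag + (C * g `|A (x - xdag)|)%:E)%E).
Variables (delta : R) (yd : Y).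
Hypotheses (delta_gt0 : 0 < delta) (noise : `|A xdag - yd| <= delta).

Local Notation xr := (tikhonov_minimizer A Reg yd).
Local Notation res gamma := (`|A (xr gamma) - yd|).
Local Notation gap gamma := (fine (Reg (xr gamma)) - fine (Reg xdag)).

Lemma minimizer_dom (gamma : R) : 0 < gamma -> dom Reg (xr gamma).
Proof.
by move=> gamma_gt0; have [] := tikhonov_minimizerP hZ hY A_cont Reg_ge0
  Reg_stab yd gamma_gt0 xdag_dom.
Qed.

Lemma minimizer_gap (gamma : R) : 0 < gamma ->
  res gamma ^+ 2 + 2 * (gamma * gap gamma) <= delta ^+ 2.
Proof.
move=> gamma_gt0; have [_] := tikhonov_minimizerP hZ hY A_cont Reg_ge0
  Reg_stab yd gamma_gt0 xdag_dom.
rewrite /tikhonov_value mulrBr.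
have : `|A xdag - yd| ^+ 2 <= delta ^+ 2.
  by rewrite lerXn2r// nnegrE ?normr_ge0// ltW.
move: (res gamma ^+ 2) (`|_| ^+ 2) (gamma * fine _) (gamma * fine _).
by move=> a b c d; lra.
Qed.

Lemma minimizer_error (gamma : R) : 0 < gamma ->
  lambda * E (xr gamma) xdag <= gap gamma + C * g (res gamma + delta).
Proof.
move=> gamma_gt0; have xdom := minimizer_dom gamma_gt0.
have := VI xdom; rewrite (dom_fineK Reg_ge0 xdom).
rewrite (dom_fineK Reg_ge0 xdag_dom) /= lee_fin => /le_trans; apply.
rewrite lerD2l ler_pM2l//; apply: index_function_le => //; first exact: g_index.1.
rewrite raddfB (le_trans (ler_distD yd _ _))// lerD2l.
by rewrite distrC.
Qed.

Lemma g_delta_gt0 : 0 < g delta.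
Proof. by have [[g_gt0 _ _ _ _] _] := g_index; exact: g_gt0. Qed.

(** The scaling bound for [c = (d + delta) / delta], cleared of its denominator. *)
Lemma g_residual (d : R) : 0 <= d ->
  delta * g (d + delta) <= 2 * (d + delta) * g delta.
Proof.
move=> d0; have c1 : 1 <= (d + delta) / delta.
  by rewrite ler_pdivlMr// mul1r lerDr.
have := concave_index_scale g_index c1 delta_gt0.
rewrite divfK ?gt_eqF// => gle.
have -> : 2 * (d + delta) * g delta =
    delta * (2 * ((d + delta) / delta) * g delta) by field; rewrite gt_eqF.
by rewrite ler_pM2l.
Qed.

Lemma TDP_error (tau1 tau2 gamma : R) : 1 <= tau1 ->
  is_TDP A delta yd xr tau1 tau2 gamma ->
  E (xr gamma) xdag <= 2 * C * (tau2 + 1) / lambda * g delta.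
Proof.
move=> tau1_ge1 [gamma_gt0 /andP[lo hi]].
have := minimizer_gap gamma_gt0; have := minimizer_error gamma_gt0.
have := g_residual (normr_ge0 (A (xr gamma) - yd)).
have d_ge : delta <= res gamma by apply: le_trans lo; rewrite ler_peMl// ltW.
have d2 : delta ^+ 2 <= res gamma ^+ 2.
  by rewrite lerXn2r// nnegrE ?normr_ge0// ltW.
move: (res gamma) hi d_ge d2 => d hi d_ge d2 gle Ele gaple.
have gap0 : gap gamma <= 0.
  by rewrite -(pmulr_rle0 _ gamma_gt0); lra.
have gdd : g (d + delta) <= 2 * (tau2 + 1) * g delta.
  rewrite -(ler_pM2l delta_gt0); apply: le_trans gle _.
  have -> : delta * (2 * (tau2 + 1) * g delta) =
    2 * (tau2 * delta + delta) * g delta by ring.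
  by rewrite ler_pM2r ?g_delta_gt0// ler_pM2l// lerD2r.
rewrite mulrAC ler_pdivlMr// mulrC; apply: le_trans Ele _.
have : C * g (d + delta) <= C * (2 * (tau2 + 1) * g delta) by rewrite ler_pM2l.
by lra.
Qed.

Lemma large_residual_parameter (tau beta : R) : 1 < tau -> 0 < beta ->
  tau * delta < res beta ->
  (1 - tau^-1) * delta ^+ 2 <= 8 * C * beta * g delta.
Proof.
move=> tau1 beta_gt0 lo.
have := minimizer_gap beta_gt0; have := minimizer_error beta_gt0.
have := g_residual (normr_ge0 (A (xr beta) - yd)).
have E0 : 0 <= lambda * E (xr beta) xdag.
  by apply: mulr_ge0; [exact: ltW|apply: E_ge0 => //; exact: minimizer_dom].
have tau_gt0 : 0 < tau by lra.
have dd : delta <= tau^-1 * res beta.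
  by rewrite mulrC ler_pdivlMr// mulrC ltW.
have d_ge : delta < res beta.
  by apply: le_lt_trans lo; rewrite ler_peMl ?ltW.
move: (res beta) d_ge dd => d d_ge dd gle Ele gaple.
have d_gt0 : 0 < d by exact: lt_trans d_ge.
have gd := g_delta_gt0.
set k := tau^-1 in dd *.
have k1 : k < 1 by rewrite invf_lt1.
(* Nonnegativity of [E] gives the lower bound [- C g (d + delta)] on the gap, inserted into the
   minimality inequality. *)
have h1 : d ^+ 2 - delta ^+ 2 <= 2 * beta * (C * g (d + delta)).
  have : 0 <= beta * (gap beta + C * g (d + delta)).
    by apply: mulr_ge0; [exact: ltW|exact: le_trans E0 Ele].
  by rewrite mulrDr; lra.
have h2 : (d ^+ 2 - delta ^+ 2) * delta <= 4 * C * beta * g delta * (d + delta).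
  apply: le_trans (_ : 2 * beta * (C * g (d + delta)) * delta <= _).
    by rewrite ler_pM2r.
  have -> : 2 * beta * (C * g (d + delta)) * delta =
    2 * beta * C * (delta * g (d + delta)) by ring.
  have -> : 4 * C * beta * g delta * (d + delta) =
    2 * beta * C * (2 * (d + delta) * g delta) by ring.
  by rewrite ler_pM2l// !mulr_gt0.
(* The factor [d + delta] of the difference of squares cancels the one from the growth of [g], so no
   upper bound on [d] is required. *)
have h3 : (d - delta) * delta <= 4 * C * beta * g delta.
  rewrite -(@ler_pM2r _ (d + delta)); last exact: addr_gt0.
  by apply: le_trans h2; rewrite le_eqVlt; apply/orP; left; apply/eqP; ring.
have h4 : (1 - k) * delta <= d - delta.
  have : (1 - k) * delta <= (1 - k) * d by rewrite ler_pM2l; lra.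
  by lra.
have h5 : (1 - k) * delta ^+ 2 <= (d - delta) * delta.
  by rewrite expr2 mulrA ler_pM2r.
have : 0 < C * beta * g delta by rewrite !mulr_gt0.
by lra.
Qed.

Lemma SDP_error (tau q gamma0 gamma : R) :
  1 < tau -> 0 < q -> 0 < gamma0 ->
  is_SDP A delta yd xr tau q gamma0 gamma ->
  E (xr gamma) xdag <=
    (4 * C / (q * (1 - tau^-1)) + 2 * C * (tau + 1)) / lambda * g delta.
Proof.
move=> tau1 q_gt0 gamma0_gt0 [[j gammaE] /andP[hi lo]].
have gamma_gt0 : 0 < gamma by rewrite gammaE mulr_gt0// exprn_gt0.
have beta_gt0 : 0 < gamma / q by rewrite divr_gt0.
have hb := large_residual_parameter tau1 beta_gt0 lo.
have := minimizer_gap gamma_gt0; have := minimizer_error gamma_gt0.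
have := g_residual (normr_ge0 (A (xr gamma) - yd)).
move: (res gamma) hi (normr_ge0 (A (xr gamma) - yd)) => d hi d0 gle Ele gaple.
have gd := g_delta_gt0.
have k0 : 0 < 1 - tau^-1 by rewrite subr_gt0 invf_lt1//; lra.
have gdd : C * g (d + delta) <= C * (2 * (tau + 1) * g delta).
  rewrite ler_pM2l// -(ler_pM2l delta_gt0); apply: le_trans gle _.
  have -> : delta * (2 * (tau + 1) * g delta) =
    2 * (tau * delta + delta) * g delta by ring.
  by rewrite ler_pM2r// ler_pM2l// lerD2r.
(* Dropping [d^2] leaves [2 gamma gap <= delta^2]; the large residual at [gamma / q] then bounds
   [delta^2], and the factor 2 turns 8 into 4. *)
have gapd : gap gamma <= 4 * C / (q * (1 - tau^-1)) * g delta.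
  rewrite -(ler_pM2l gamma_gt0) -(ler_pM2l k0).
  have -> : (1 - tau^-1) * (gamma * (4 * C / (q * (1 - tau^-1)) * g delta)) =
      4 * C * (gamma / q) * g delta.
    by field; rewrite !gt_eqF ?andbT//; lra.
  have : (1 - tau^-1) * (2 * (gamma * gap gamma)) <= (1 - tau^-1) * delta ^+ 2.
    by rewrite ler_pM2l//; have := sqr_ge0 d; lra.
  by move: (gamma * gap _) (gamma / q) hb => a b; lra.
rewrite mulrAC ler_pdivlMr// mulrC mulrDl; apply: le_trans Ele _.
by apply: lerD => //; apply: le_trans gdd _; rewrite !mulrA [C * 2]mulrC.
Qed.

Lemma lepskii_bound_small (gamma : R) : 0 < gamma ->
  gamma * (C * g delta) <= delta ^+ 2 ->
  E (xr gamma) xdag <= lepskii_bound delta lambda gamma.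
Proof.
move=> gamma_gt0 small.
have := minimizer_gap gamma_gt0; have := minimizer_error gamma_gt0.
have := g_residual (normr_ge0 (A (xr gamma) - yd)).
move: (res gamma) (normr_ge0 (A (xr gamma) - yd)) => d d0 gle Ele gaple.
rewrite /lepskii_bound ler_pdivlMr ?mulr_gt0//.
have h1 : gamma * (C * g (d + delta)) <= 2 * (d + delta) * delta.
  rewrite -(ler_pM2l delta_gt0).
  have -> : delta * (gamma * (C * g (d + delta))) =
     gamma * C * (delta * g (d + delta)) by ring.
  apply: le_trans (_ : gamma * C * (2 * (d + delta) * g delta) <= _).
    by rewrite ler_pM2l// mulr_gt0.
  have -> : gamma * C * (2 * (d + delta) * g delta) =
    2 * (d + delta) * (gamma * (C * g delta)) by ring.
  have -> : delta * (2 * (d + delta) * delta) =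
    2 * (d + delta) * delta ^+ 2 by ring.
  by rewrite ler_pM2l// mulr_gt0// ltr_wpDl.
have h2 : gamma * (lambda * E (xr gamma) xdag) <=
    gamma * (gap gamma + C * g (d + delta)) by rewrite ler_pM2l.
have -> : E (xr gamma) xdag * (2 * lambda * gamma) =
  2 * (gamma * (lambda * E (xr gamma) xdag)) by ring.
move: h2 h1 gaple; rewrite mulrDr.
move: (gamma * (lambda * _)) (gamma * (C * _)) (gamma * gap _) => a b c.
(* Completing the square in [delta^2 - d^2 + 4 (d + delta) delta] gives at most [9 delta^2], within
   the prescribed 17. *)
have := sqr_ge0 (d - 2 * delta); have := sqr_ge0 delta.
by nra.
Qed.

(** The index [k] precedes the first grid point with [gamma C g(delta) > delta^2]; one grid step
    costs the factor [q]. If already [gamma0] is that large, [k = 0] and the assumption on [gamma0]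
    supplies the error bound. *)
Lemma lepskii_grid_opt (q gamma0 : R) : 0 < q -> q < 1 -> 0 < gamma0 ->
  E (xr gamma0) xdag <= lepskii_bound delta lambda gamma0 ->
  exists k : nat, q * delta ^+ 2 <= gamma0 / q ^+ k * (C * g delta) /\
    forall i : nat, (i <= k)%N ->
      E (xr (gamma0 / q ^+ i)) xdag
        <= lepskii_bound delta lambda (gamma0 / q ^+ i).
Proof.
move=> q0 q1 gamma00 E0.
have gd := g_delta_gt0.
have grid0 i : 0 < gamma0 / q ^+ i by rewrite divr_gt0// exprn_gt0.
pose big i := delta ^+ 2 < gamma0 / q ^+ i * (C * g delta).
have bigex : exists i, big i.
  have qq : `|q| < 1 by rewrite gtr0_norm.
  have e0 : 0 < gamma0 * (C * g delta) / delta ^+ 2.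
    by rewrite divr_gt0 ?mulr_gt0// exprn_gt0.
  (* [big i] amounts to [q^i < gamma0 C g(delta) / delta^2], which holds eventually as [q^i] tends
     to 0. *)
  have /cvgrPdist_lt/(_ _ e0)[N _ NP] := cvg_expr qq.
  exists N; have := NP N (leqnn N).
  rewrite sub0r normrN gtr0_norm ?exprn_gt0// ltr_pdivlMr ?exprn_gt0//.
  by rewrite /big mulrAC ltr_pdivlMr ?exprn_gt0// mulrC.
have [[|k] bigk mink] := ex_minnP bigex.
- exists 0%N; split.
    apply: ltW; apply: le_lt_trans bigk.
    by rewrite ler_piMl ?ltW// exprn_gt0.
  by move=> i; rewrite leqn0 => /eqP ->; rewrite expr0 divr1.
- exists k; split.
    have -> : gamma0 / q ^+ k = q * (gamma0 / q ^+ k.+1).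
      by rewrite exprS; field; rewrite expf_neq0 ?lt0r_neq0.
    by rewrite -mulrA ler_pM2l// ltW.
  move=> i ik; apply: lepskii_bound_small => //.
  rewrite leNgt; apply/negP => /mink.
  by rewrite ltnNge ik.
Qed.

Lemma LEP_error (CE q gamma0 gamma : R) : 1 <= CE -> 0 < q -> q < 1 ->
  (forall x1 x2 : Z, dom Reg x1 -> dom Reg x2 -> E x1 x2 = E x2 x1) ->
  (forall x1 x2 x3 : Z, dom Reg x1 -> dom Reg x2 -> dom Reg x3 ->
     E x1 x2 <= CE * (E x1 x3 + E x3 x2)) ->
  0 < gamma0 ->
  E (xr gamma0) xdag <= lepskii_bound delta lambda gamma0 ->
  is_LEP delta xr E lambda CE q gamma0 gamma ->
  E (xr gamma) xdag <=
    CE * (2 * CE + 1) * (17%:R * C / (2 * lambda * q)) * g delta.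
Proof.
move=> CE1 q0 q1 Esym Etri gamma00 E0 [[[j gammaE] adm] gamma_max].
have gd := g_delta_gt0.
have grid0 i : 0 < gamma0 / q ^+ i by rewrite divr_gt0// exprn_gt0.
have grid_dom i : dom Reg (xr (gamma0 / q ^+ i)) by exact: minimizer_dom.
have [k [kbig kE]] := lepskii_grid_opt q0 q1 gamma00 E0.
pose opt := gamma0 / q ^+ k.
pose T gamma' := lepskii_bound delta lambda gamma'.
have T_anti a b : 0 < a -> a <= b -> T b <= T a.
  move=> a0 ab; have b0 := lt_le_trans a0 ab.
  rewrite /T /lepskii_bound ler_pM2l ?mulr_gt0 ?exprn_gt0//.
  by rewrite lef_pV2 ?posrE ?mulr_gt0// ler_pM2l// mulr_gt0.
have T0 a : 0 < a -> 0 <= T a.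
  by move=> a0; rewrite divr_ge0 ?mulr_ge0 ?sqr_ge0 ?ltW.
(* Quasi-triangle inequality through [xdag]: both errors are at most [T gamma'], since [T] is
   decreasing and [gamma' < opt]. *)
have opt_adm : lepskii_admissible delta xr E lambda CE q gamma0 opt.
  split; first by exists k.
  move=> _ [i ->] /andP[_ lt_opt].
  have ik : (i <= k)%N.
    rewrite leqNgt; apply/negP => ki; move: lt_opt; rewrite ltNge => /negP.
    apply; rewrite ler_pM2l// lef_pV2 ?posrE ?exprn_gt0//.
    by apply: ler_wiXn2l; rewrite ?(ltW q0) ?(ltW q1) ?(ltnW ki).
  apply: le_trans (Etri _ _ _ (grid_dom _) (grid_dom _) xdag_dom) _.
  rewrite [E xdag _]Esym// [2 * CE]mulrC -mulrA ler_pM2l; last by lra.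
  rewrite mulr_natl mulr2n; apply: lerD; first exact: kE.
  by apply: le_trans (kE k _) _ => //; apply: T_anti => //; exact: ltW.
have opt_le : opt <= gamma by exact: gamma_max.
(* Admissibility of [gamma] compares it with strictly smaller grid points, so equality is a separate
   case. *)
have opt_gamma : E (xr opt) (xr gamma) <= 2 * CE * T opt \/ gamma = opt.
  move: opt_le; rewrite le_eqVlt => /predU1P[<-|lt]; first by right.
  left; apply: adm; first by exists k.
  rewrite lt andbT /opt ler_pdivlMr ?exprn_gt0// ger_pMr//.
  by apply: exprn_ile1; exact: ltW.
have Topt : T opt <= 17%:R * C / (2 * lambda * q) * g delta.
  rewrite /T /lepskii_bound ler_pdivrMr; last first.
    by apply: mulr_gt0; [exact: mulr_gt0|exact: grid0].
  have -> : 17%:R * C / (2 * lambda * q) * g delta * (2 * lambda * opt) =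
      17%:R * ((opt * (C * g delta)) / q) by field; rewrite !gt_eqF.
  by rewrite ler_pM2l// ler_pdivlMr// mulrC.
have gamma_dom : dom Reg (xr gamma) by rewrite gammaE.
apply: (@le_trans _ _ (CE * (2 * CE + 1) * T opt)); last first.
  by rewrite -!mulrA !ler_pM2l; [rewrite !mulrA in Topt *|lra|lra].
have kk := kE k (leqnn k); rewrite -/opt -/(T opt) in kk.
have T0opt := T0 _ (grid0 k); rewrite -/opt in T0opt.
case: opt_gamma => [h|->]; last first.
  apply: le_trans kk _; rewrite ler_peMl//.
  by nra.
(* Passing through [xr opt] adds [2 CE T opt] and [T opt], whence the factor [CE (2 CE + 1)]. *)
apply: le_trans (Etri _ _ _ gamma_dom xdag_dom (grid_dom k)) _.
rewrite -mulrA ler_pM2l; last by lra.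
rewrite -/opt Esym//; last exact: grid_dom.
by lra.
Qed.

End rates.

(** * Convergence rates as the noise level tends to 0 *)

Theorem proposition2 (R : realType) (Z Y : completeNormedModType R)
  (hZ : is_hilbert Z) (hY : is_hilbert Y)
  (A : {linear Z -> Y})
  (A_inj : injective A)
  (A_bounded : bounded_near A (nbhs (0 : Z)))
  (A_range : ~ closed (range A))
  (Reg : Z -> \bar R)
  (Reg_ge0 : forall x : Z, (0 <= Reg x)%E)
  (Reg_convex : convex_functional Reg)
  (Reg_lsc : lower_semicontinuous Reg)
  (Reg_stab : stabilizing Reg)
  (xdag : Z) (xdag_dom : dom Reg xdag)
  (E : Z -> Z -> R)
  (E_ge0 : forall x1 x2 : Z, dom Reg x1 -> dom Reg x2 -> 0 <= E x1 x2)
  (lambda C : R) (lambda_gt0 : 0 < lambda) (lambda_le1 : lambda <= 1)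
  (C_gt0 : 0 < C)
  (g : R -> R) (g_index : concave_index_function g)
  (VI : forall x : Z, dom Reg x ->
     ((lambda * E x xdag)%:E
        <= Reg x - Reg xdag + (C * g `|A (x - xdag)|)%:E)%E) :
  [/\ forall tau1 tau2 : R, 1 <= tau1 -> tau1 <= tau2 ->
        error_rate A Reg E xdag g (fun delta yd gamma =>
          is_TDP A delta yd (tikhonov_minimizer A Reg yd) tau1 tau2 gamma),
      forall tau q gamma0 : R, 1 < tau -> 0 < q -> q < 1 -> 0 < gamma0 ->
        error_rate A Reg E xdag g (fun delta yd gamma =>
          is_SDP A delta yd (tikhonov_minimizer A Reg yd) tau q gamma0 gamma)
    & forall CE q : R, 1 <= CE -> 0 < q -> q < 1 ->
        (forall x1 x2 : Z, dom Reg x1 -> dom Reg x2 -> E x1 x2 = E x2 x1) ->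
        (forall x1 x2 x3 : Z, dom Reg x1 -> dom Reg x2 -> dom Reg x3 ->
           E x1 x2 <= CE * (E x1 x3 + E x3 x2)) ->
        error_rate A Reg E xdag g (fun delta yd gamma =>
          exists2 gamma0 : R,
            0 < gamma0 /\
            E (tikhonov_minimizer A Reg yd gamma0) xdag
              <= lepskii_bound delta lambda gamma0
          & is_LEP delta (tikhonov_minimizer A Reg yd)
              E lambda CE q gamma0 gamma)].
Proof.
have A_cont : continuous A by exact/linear_bounded_continuous.
split.
- move=> tau1 tau2 tau1_ge1 _; exists (2 * C * (tau2 + 1) / lambda).
  (* The estimate holds for every positive [delta]; the right neighbourhood of 0 supplies just that
     positivity. *)
  near=> delta => yd gamma noise rule.
  by apply: TDP_error tau1_ge1 rule.
- move=> tau q gamma0 tau_gt1 q_gt0 _ gamma0_gt0.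
  exists ((4 * C / (q * (1 - tau^-1)) + 2 * C * (tau + 1)) / lambda).
  near=> delta => yd gamma noise rule.
  by apply: SDP_error tau_gt1 q_gt0 gamma0_gt0 rule.
- move=> CE q CE_ge1 q_gt0 q_lt1 Esym Etri.
  (* The constant is free of [gamma0], which may therefore vary with [delta] and the data. *)
  exists (CE * (2 * CE + 1) * (17%:R * C / (2 * lambda * q))).
  near=> delta => yd gamma noise [gamma0 [gamma0_gt0 gamma0_small] rule].
  by apply: LEP_error CE_ge1 q_gt0 q_lt1 Esym Etri gamma0_gt0 gamma0_small rule.
Unshelve. all: by end_near. Qed.
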